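(* Let $\hat h$ be the Hamiltonian of a $d$-dimensional quantum system ($d<\infty$) with ground-state energy $0$, and let $\Lambda$ be any linear, completely positive, trace preserving (LCPT) map on that system. For any $\mathfrak{e}\in[0,\|\hat h\|_\infty]$, $$C_{\rm loc}(\Lambda;\mathfrak{e}) = C_{\rm loc,sep}(\Lambda;\mathfrak{e}) = \chi(\Lambda;\mathfrak{e}),\qquad \chi(\Lambda;\mathfrak{e}) := \sup_{\{p_j,\mathfrak{e}_j\}}\sum_j p_j\,\mathcal{E}^{(1)}(\Lambda;\mathfrak{e}_j),$$ where the supremum is taken over all distributions $\{p_j,\mathfrak{e}_j\}$ (probabilities $p_j\ge 0$, $\sum_j p_j=1$, and energies $\mathfrak{e}_j\in[0,\|\hat h\|_\infty]$) that fulfil the constraint $\sum_j p_j\mathfrak{e}_j\le\mathfrak{e}$.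
   Context: A quantum cell (q-cell) is a system with Hilbert space $\mathbb{C}^d$ and self-adjoint Hamiltonian $\hat h$ whose smallest eigenvalue is $0$; $\|\hat h\|_\infty$ is its operator norm. For $n\ge1$, $n$ non-interacting q-cells have Hilbert space $(\mathbb{C}^d)^{\otimes n}$ and Hamiltonian $\hat H^{(n)}=\hat h_1+\dots+\hat h_n$, where $\hat h_i$ acts as $\hat h$ on the $i$-th factor and as the identity on the others. States are density matrices. The mean energy of a state $\hat\rho$ with respect to a Hamiltonian $\hat H$ is $\mathfrak{E}(\hat\rho;\hat H):=\mathrm{Tr}[\hat\rho\hat H]$. Noise acts on $n$ q-cells as $\Lambda^{\otimes n}$. Ergotropy of a state $\hat\rho$ of a $D$-dimensional system with Hamiltonian $\hat H$: $\mathcal{E}(\hat\rho;\hat H):=\max_{\hat U\in\mathbb{U}(D)}\{\mathfrak{E}(\hat\rho;\hat H)-\mathfrak{E}(\hat U\hat\rho\hat U^\dagger;\hat H)\}$, where $\mathbb{U}(D)$ is the group of $D\times D$ unitary matrices. Local ergotropy of a state $\hat\rho$ of $n$ q-cells: $\mathcal{E}_{\rm loc}(\hat\rho;\hat H^{(n)}):=\max_{\hat U_1,\dots,\hat U_n\in\mathbb{U}(d)}\{\mathfrak{E}(\hat\rho;\hat H^{(n)})-\mathfrak{E}((\hat U_1\otimes\cdots\otimes\hat U_n)\hat\rho(\hat U_1\otimes\cdots\otimes\hat U_n)^\dagger;\hat H^{(n)})\}$. Let $\mathfrak{S}^{(n)}_E$ be the set of states $\hat\rho^{(n)}$ of $n$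 q-cells with $\mathfrak{E}(\hat\rho^{(n)};\hat H^{(n)})\le E$, and $\mathfrak{S}^{(n)}_{E,\rm sep}$ the subset of (fully) separable states, i.e. convex combinations of product states over the $n$ q-cells. Define $\mathcal{E}^{(n)}(\Lambda;E):=\max_{\hat\rho^{(n)}\in\mathfrak{S}^{(n)}_E}\mathcal{E}(\Lambda^{\otimes n}(\hat\rho^{(n)});\hat H^{(n)})$ (in particular $\mathcal{E}^{(1)}(\Lambda;\mathfrak{e})$ is the maximum of $\mathcal{E}(\Lambda(\hat\rho);\hat h)$ over single q-cell states of mean energy at most $\mathfrak{e}$), $\mathcal{E}^{(n)}_{\rm loc}(\Lambda;E):=\max_{\hat\rho^{(n)}\in\mathfrak{S}^{(n)}_E}\mathcal{E}_{\rm loc}(\Lambda^{\otimes n}(\hat\rho^{(n)});\hat H^{(n)})$, $\mathcal{E}^{(n)}_{\rm loc,sep}(\Lambda;E):=\max_{\hat\rho^{(n)}\in\mathfrak{S}^{(n)}_{E,\rm sep}}\mathcal{E}_{\rm loc}(\Lambda^{\otimes n}(\hat\rho^{(n)});\hat H^{(n)})$. The capacitances are $C_{\rm loc}(\Lambda;\mathfrak{e}):=\lim_{n\to\infty}\mathcal{E}^{(n)}_{\rm loc}(\Lambda;n\mathfrak{e})/n$ (local ergotropy capacitance) and $C_{\rm loc,sep}(\Lambda;\mathfrak{e}):=\lim_{n\to\infty}\mathcal{E}^{(n)}_{\rm loc,sep}(\Lambda;n\mathfrak{e})/n$ (separable-input, local ergotropy capacitance); these limits exist. *)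

(* Defs.v *)
From HB Require Import structures.
From mathcomp Require Import all_boot all_order all_algebra.
From mathcomp Require Import spectral sesquilinear.
From mathcomp Require Import all_classical all_reals all_analysis.
From mathcomp Require Import complex mxtens.

Set Implicit Arguments.
Unset Strict Implicit.
Unset Printing Implicit Defensive.
Import Order.TTheory GRing.Theory Num.Theory.
Import numFieldNormedType.Exports.

Local Open Scope classical_set_scope.
Local Open Scope sesquilinear_scope.
Local Open Scope ring_scope.

(* Every maximum of the theory is written as [sup]: all the sets involved are
   images of nonempty compact sets under continuous functions (for an energy
   bound >= 0 and a Hamiltonian with ground energy 0), so the two agree. *)

Section SingleSystem.
Variable R : realType.
Implicit Types D d k : nat.

Definition psdmx D (A : 'M[R[i]]_D) : Prop :=
  A \is hermsymmx /\ forall v : 'cV[R[i]]_D, 0 <= (v ^t* *m A *m v) 0 0.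

Definition is_state D (rho : 'M[R[i]]_D) : Prop := psdmx rho /\ \tr rho = 1.

(* The trace is real for Hermitian arguments; [Re] only changes its type. *)
Definition mean_energy D (rho H : 'M[R[i]]_D) : R := complex.Re (\tr (rho *m H)).

Definition vnorm D (v : 'cV[R[i]]_D) : R :=
  Num.sqrt (complex.Re ((v ^t* *m v) 0 0)).

Definition opnorm D (A : 'M[R[i]]_D) : R :=
  sup [set vnorm (A *m v) | v in [set v : 'cV[R[i]]_D | vnorm v = 1]].

(* The requirement that 0 be an eigenvalue forces 0 < D. *)
Definition is_cell_hamiltonian D (h : 'M[R[i]]_D) : Prop :=
  [/\ h \is hermsymmx, eigenvalue h 0 &
      forall a : R[i], eigenvalue h a -> 0 <= a].

Definition ergotropy D (rho H : 'M[R[i]]_D) : R :=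
  sup [set mean_energy rho H - mean_energy (U *m rho *m U ^t*) H
      | U in [set U : 'M[R[i]]_D | U \is unitarymx]].

Definition energy_states D (H : 'M[R[i]]_D) (E : R) : set 'M[R[i]]_D :=
  [set rho | is_state rho /\ mean_energy rho H <= E].

(* The map id (x) L on C^k (x) C^d, written on the k x k array of d x d blocks
   of X. *)
Definition ampliation k d (L : 'M[R[i]]_d -> 'M[R[i]]_d)
    (X : 'M[R[i]]_(k * d)) : 'M[R[i]]_(k * d) :=
  \sum_(i < k) \sum_(j < k)
    tensmx (delta_mx i j)
      (L (\matrix_(a < d, b < d) X (mxtens_index (i, a)) (mxtens_index (j, b)))).

Definition completely_positive d (L : 'M[R[i]]_d -> 'M[R[i]]_d) : Prop :=
  forall k (X : 'M[R[i]]_(k * d)), psdmx X -> psdmx (ampliation L X).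

Definition trace_preserving d (L : 'M[R[i]]_d -> 'M[R[i]]_d) : Prop :=
  forall X : 'M[R[i]]_d, \tr (L X) = \tr X.

Definition max_ergotropy1 d (L : 'M[R[i]]_d -> 'M[R[i]]_d)
    (h : 'M[R[i]]_d) (e : R) : R :=
  sup [set ergotropy (L rho) h | rho in energy_states h e].

Definition chi d (L : 'M[R[i]]_d -> 'M[R[i]]_d) (h : 'M[R[i]]_d) (e : R) : R :=
  sup [set x | exists (m : nat) (p en : 'I_m -> R),
    [/\ forall j, 0 <= p j, \sum_j p j = 1,
        forall j, 0 <= en j <= opnorm h, \sum_j p j * en j <= e &
        x = \sum_j p j * max_ergotropy1 L h (en j)]].

End SingleSystem.

(* The product basis of (C^d)^(x)n is indexed by {ffun 'I_n -> 'I_d}, through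
   its enumeration, so that operators are ordinary square matrices. *)
Notation nbasis n d := #|{: {ffun 'I_n -> 'I_d}}|.

Definition letters n d (a : 'I_(nbasis n d)) : {ffun 'I_n -> 'I_d} :=
  enum_val a.

Section ManyCells.
Variable R : realType.
Implicit Types n d : nat.

Definition tensor n d (A : 'I_n -> 'M[R[i]]_d) : 'M[R[i]]_(nbasis n d) :=
  \matrix_(a, b) \prod_(i < n) A i (letters a i) (letters b i).

Definition total_hamiltonian n d (h : 'M[R[i]]_d) : 'M[R[i]]_(nbasis n d) :=
  \sum_(i < n) tensor (fun j : 'I_n => if j == i then h else 1%:M).

(* The linear map sending A_1 (x) ... (x) A_n to L A_1 (x) ... (x) L A_n,
   obtained by expanding X in the matrix units
   |a><b| = |a_1><b_1| (x) ... (x) |a_n><b_n|. *)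
Definition tensor_map n d (L : 'M[R[i]]_d -> 'M[R[i]]_d)
    (X : 'M[R[i]]_(nbasis n d)) : 'M[R[i]]_(nbasis n d) :=
  \sum_a \sum_b
    X a b *: tensor (fun i => L (delta_mx (letters a i) (letters b i))).

Definition separable n d (rho : 'M[R[i]]_(nbasis n d)) : Prop :=
  exists (m : nat) (p : 'I_m -> R) (s : 'I_m -> 'I_n -> 'M[R[i]]_d),
    [/\ forall k, 0 <= p k, \sum_k p k = 1,
        forall k i, is_state (s k i) &
        rho = \sum_k (p k)%:C%C *: tensor (s k)].

Definition local_ergotropy n d (h : 'M[R[i]]_d)
    (rho : 'M[R[i]]_(nbasis n d)) : R :=
  let H := total_hamiltonian n h in
  sup [set mean_energy rho H
           - mean_energy (tensor U *m rho *m (tensor U) ^t*) H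
      | U in [set U : 'I_n -> 'M[R[i]]_d | forall i, U i \is unitarymx]].

Definition max_local_ergotropy n d (L : 'M[R[i]]_d -> 'M[R[i]]_d)
    (h : 'M[R[i]]_d) (E : R) : R :=
  sup [set local_ergotropy h (tensor_map L rho)
      | rho in energy_states (total_hamiltonian n h) E].

Definition max_local_ergotropy_sep n d (L : 'M[R[i]]_d -> 'M[R[i]]_d)
    (h : 'M[R[i]]_d) (E : R) : R :=
  sup [set local_ergotropy h (tensor_map L rho)
      | rho in energy_states (total_hamiltonian n h) E `&` @separable n d].

Definition local_rate d (L : 'M[R[i]]_d -> 'M[R[i]]_d)
    (h : 'M[R[i]]_d) (e : R) : R^nat :=
  fun n => max_local_ergotropy n L h (n%:R * e) / n%:R.

Definition local_rate_sep d (L : 'M[R[i]]_d -> 'M[R[i]]_d)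
    (h : 'M[R[i]]_d) (e : R) : R^nat :=
  fun n => max_local_ergotropy_sep n L h (n%:R * e) / n%:R.

Definition C_loc d (L : 'M[R[i]]_d -> 'M[R[i]]_d) (h : 'M[R[i]]_d) (e : R) : R :=
  limn (local_rate L h e).

Definition C_loc_sep d (L : 'M[R[i]]_d -> 'M[R[i]]_d) (h : 'M[R[i]]_d)
    (e : R) : R :=
  limn (local_rate_sep L h e).

End ManyCells.

(* Main.v *)
(* The Hamiltonian and the unitaries of the local ergotropy act cell by cell, so
   for an input rho the local ergotropy of the output is the sum over the cells
   of the ergotropies of L (rho_j), with rho_j the marginal on cell j.  Hence
   entanglement is useless: product inputs do as well, and the n-cell maximum is
   the largest value of sum_j E1(e_j) over energies with sum_j e_j <= n e.  This
   is n times chi restricted to uniform distributions on n points, and chi is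
   recovered in the limit by rounding an arbitrary distribution. *)

Require Import Defs.
From mathcomp Require Import all_boot all_order all_algebra.
From mathcomp Require Import spectral sesquilinear.
From mathcomp Require Import all_classical all_reals all_analysis.
From mathcomp Require Import complex mxtens.
From mathcomp Require Import lra.

Import Order.TTheory GRing.Theory Num.Theory.
Import numFieldNormedType.Exports.
Local Open Scope classical_set_scope.
Local Open Scope sesquilinear_scope.
Local Open Scope ring_scope.

Set Implicit Arguments.
Unset Strict Implicit.
Unset Printing Implicit Defensive.

(** * Positive semidefinite matrices as Gram matrices *)

Section PositiveMatrices.
Variable R : realType.
Implicit Types m n D : nat.

Lemma trmxC_mul m n p (A : 'M[R[i]]_(m, n)) (B : 'M[R[i]]_(n, p)) :
  (A *m B)^t* = B^t* *m A^t*.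
Proof. by rewrite trmx_mul map_mxM. Qed.

Lemma trmxC_scale m n (a : R[i]) (A : 'M[R[i]]_(m, n)) :
  (a *: A)^t* = a^* *: A^t*.
Proof. by apply/matrixP => j k; rewrite !mxE rmorphM. Qed.

Lemma hermsymmxP D (A : 'M[R[i]]_D) : A \is hermsymmx <-> A^t* = A.
Proof.
split=> [hA|hA].
  by have := is_hermitianmxP _ _ _ hA; rewrite expr0 scale1r => <-.
by apply/is_hermitianmxP; rewrite expr0 scale1r hA.
Qed.

Lemma mul_trmxC_ge0 m n (A : 'M[R[i]]_(m, n)) i : 0 <= (A^t* *m A) i i.
Proof.
rewrite mxE sumr_ge0 // => k _; rewrite !mxE mulrC; exact: mul_conjC_ge0.
Qed.

Lemma psdmx_gram m D (B : 'M[R[i]]_(m, D)) : psdmx (B^t* *m B).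
Proof.
split; first by apply/hermsymmxP; rewrite trmxC_mul trmxCK.
move=> v; suff -> : v^t* *m (B^t* *m B) *m v = (B *m v)^t* *m (B *m v).
  exact: mul_trmxC_ge0.
by rewrite trmxC_mul !mulmxA.
Qed.

(** Eigenvectors here are row vectors [v] with [v *m A = a *: v], so the form is evaluated at the
    column [v^t*], where it equals [a] times the positive number [v *m v^t*]. *)
Lemma psdmx_eigenvalue_ge0 D (A : 'M[R[i]]_D) a :
  psdmx A -> eigenvalue A a -> 0 <= a.
Proof.
move=> [_ psdA] /eigenvalueP [v vA v0].
have := psdA (v^t*); rewrite trmxCK vA -scalemxAl mxE.
have v2 : 0 < (v *m v^t*) 0 0.
  rewrite lt_def; apply/andP; split; last first.
    by rewrite -{1}[v]trmxCK mul_trmxC_ge0.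
  apply: contraNneq v0 => /eqP; rewrite mxE psumr_eq0; last first.
    by move=> k _; rewrite !mxE mul_conjC_ge0.
  move=> /allP v0; apply/eqP/rowP => k; rewrite mxE.
  by have := v0 k (mem_index_enum _); rewrite /= !mxE mul_conjC_eq0 => /eqP.
by rewrite pmulr_lge0.
Qed.

(** Spectral theorem: with [A = P^-1 diag(s) P] and [P] unitary, each [s 0 k] is an eigenvalue (its
    eigenvector is row [k] of [P]), hence nonnegative, and [B = diag(sqrt s) P] is a Gram factor. *)
Lemma hermitian_gram D (A : 'M[R[i]]_D) : A \is hermsymmx ->
  (forall a, eigenvalue A a -> 0 <= a) -> exists B : 'M[R[i]]_D, A = B^t* *m B.
Proof.
move=> hA posA; have /hermitian_normalmx/orthomx_spectralP := hA.
set P := spectralmx A; set s := spectral_diag A => eqA.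
have uP : P \is unitarymx by exact: spectral_unitarymx.
have uPi : P \in unitmx by exact: unitarymx_unit.
have s_ge0 k : 0 <= s 0 k.
  apply: posA; apply/eigenvalueP; exists (row k P).
    rewrite {1}eqA -row_mul -mulmxA mulKVmx //.
    by apply/rowP => j; rewrite mul_diag_mx !mxE.
  apply: contraTneq uP => Pk0; apply/negP => /unitarymxP/matrixP/(_ k k).
  rewrite !mxE eqxx big1 => [/eqP|j _]; first by rewrite eq_sym oner_eq0.
  by have /rowP/(_ j) := Pk0; rewrite !mxE => ->; rewrite mul0r.
exists (diag_mx (map_mx sqrtC s) *m P); rewrite {1}eqA invmx_unitary //.
rewrite trmxC_mul !mulmxA; congr (_ *m P); rewrite -mulmxA; congr (_ *m _).
apply/matrixP => j k; rewrite mul_mx_diag !mxE raddfMn /=.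
rewrite eq_sym; case: eqP => [->|_]; last by rewrite !mulr0n mul0r.
by rewrite !mulr1n geC0_conj ?sqrtC_ge0 // -expr2 sqrtCK.
Qed.

Lemma psdmxP D (A : 'M[R[i]]_D) :
  psdmx A <-> exists B : 'M[R[i]]_D, A = B^t* *m B.
Proof.
split=> [psdA|[B ->]]; last exact: psdmx_gram.
by apply: hermitian_gram => [|a]; [case: psdA | exact: psdmx_eigenvalue_ge0].
Qed.

(** With Gram factors [X] of [A] and [Y] of [B], cyclicity of the trace turns the product into the
    Gram matrix of [X *m Y^t*]. *)
Lemma psdmx_tr_mul_ge0 D (A B : 'M[R[i]]_D) :
  psdmx A -> psdmx B -> 0 <= \tr (A *m B).
Proof.
move=> /psdmxP[X ->] /psdmxP[Y ->].
rewrite mulmxA mxtrace_mulC.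
have -> : Y *m (X^t* *m X *m Y^t*) = (X *m Y^t*)^t* *m (X *m Y^t*).
  by rewrite trmxC_mul trmxCK !mulmxA.
by rewrite sumr_ge0 // => k _; exact: mul_trmxC_ge0.
Qed.

Lemma psdmx_mxsub m D (A : 'M[R[i]]_D) (f : 'I_m -> 'I_D) :
  psdmx A -> psdmx (mxsub f f A).
Proof.
move=> /psdmxP[B ->]; rewrite mxsub_mul.
suff -> : rowsub f (B^t*) = (colsub f B)^t* by exact: psdmx_gram.
by apply/matrixP => j k; rewrite !mxE.
Qed.

End PositiveMatrices.

(** * Vector norms and the operator norm *)

Section SingleCell.
Variable R : realType.
Implicit Types D d : nat.

Lemma Re_ge0 (z : R[i]) : 0 <= z -> 0 <= complex.Re z.
Proof. by rewrite lecE => /andP[]. Qed.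

Lemma RRe_ge0 (z : R[i]) : 0 <= z -> z = (complex.Re z)%:C%C.
Proof. by move=> z0; rewrite RRe_real // ger0_real. Qed.

Lemma ReD (z w : R[i]) : complex.Re (z + w) = complex.Re z + complex.Re w.
Proof. by case: z w => [? ?] []. Qed.

Lemma Re_sum (I : Type) (s : seq I) (P : pred I) (F : I -> R[i]) :
  complex.Re (\sum_(i <- s | P i) F i) = \sum_(i <- s | P i) complex.Re (F i).
Proof. exact: (big_morph _ ReD). Qed.

Lemma sqr_vnorm D (v : 'cV[R[i]]_D) :
  ((vnorm v) ^+ 2)%:C%C = (v^t* *m v) 0 0.
Proof.
have v_ge0 := mul_trmxC_ge0 v 0.
by rewrite sqr_sqrtr ?Re_ge0 // -RRe_ge0.
Qed.

Lemma vnorm_ge0 D (v : 'cV[R[i]]_D) : 0 <= vnorm v.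
Proof. exact: sqrtr_ge0. Qed.

Lemma vnormZ D (r : R) (v : 'cV[R[i]]_D) :
  0 <= r -> vnorm (r%:C%C *: v) = r * vnorm v.
Proof.
move=> r0; apply/eqP; rewrite -(@eqrXn2 _ 2%N) ?mulr_ge0 ?vnorm_ge0 //.
apply/eqP/complexI; rewrite sqr_vnorm exprMn [RHS]rmorphM /= sqr_vnorm.
rewrite trmxC_scale -scalemxAl -scalemxAr !mxE.
by rewrite geC0_conj ?ler0c // mulrA rmorphXn expr2.
Qed.

Lemma vnorm_eq0 D (v : 'cV[R[i]]_D) : (vnorm v == 0) = (v == 0).
Proof.
apply/eqP/eqP => [v0|->]; last first.
  by rewrite /vnorm mulmx0 mxE sqrtr0.
have := sqr_vnorm v; rewrite v0 expr0n /= mxE => /esym/eqP.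
rewrite psumr_eq0 => [/allP vk0|k _]; last by rewrite !mxE mulrC mul_conjC_ge0.
apply/colP => k; rewrite mxE; have := vk0 k (mem_index_enum _).
by rewrite /= !mxE mulrC mul_conjC_eq0 => /eqP.
Qed.

(** Ensures that the [sup] in [opnorm] is a genuine supremum and not the default value 0. *)
Lemma opnorm_has_ubound D (A : 'M[R[i]]_D) :
  has_ubound [set vnorm (A *m v) | v in [set v : 'cV[R[i]]_D | vnorm v = 1]].
Proof.
(* Entries of a unit vector have modulus at most 1, so entry [j] of [A *m v] is at most the absolute
   sum of row [j]; [M] adds the squares of these bounds. *)
pose M : R[i] := \sum_j (\sum_k `|A j k|) ^+ 2.
exists (Num.sqrt (complex.Re M)) => _ [v /= v1 <-].
suff : (((A *m v)^t* *m (A *m v)) 0 0) <= M.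
  by rewrite lecE => /andP[_ ?]; rewrite ler_wsqrtr.
have vk k : `|v k 0| <= 1.
  rewrite -(@ler_pXn2r _ 2) ?nnegrE // expr1n.
  have := sqr_vnorm v; rewrite v1 expr1n mxE (bigD1 k) //= !mxE.
  rewrite mulrC -normCK => v2; rewrite -[leRHS]/(1%:C%C) v2 lerDl.
  by rewrite sumr_ge0 // => j _; rewrite !mxE mulrC mul_conjC_ge0.
rewrite mxE ler_sum // => j _; rewrite !mxE mulrC -normCK.
rewrite ler_pXn2r ?nnegrE ?sumr_ge0 //.
apply: le_trans (ler_norm_sum _ _ _) _; apply: ler_sum => k _.
by rewrite normrM ler_piMr.
Qed.

Lemma vnorm_eigen_le_opnorm D (A : 'M[R[i]]_D) (a : R[i]) :
  A \is hermsymmx -> 0 <= a -> eigenvalue A a -> complex.Re a <= opnorm A.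
Proof.
move=> /hermsymmxP hA a_ge0 /eigenvalueP[u uA u0].
have v0 : u^t* != 0.
  by apply: contraNneq u0 => u0; rewrite -[u]trmxCK u0 trmx0 map_mx0.
have Av : A *m u^t* = a *: u^t*.
  by rewrite -{1}hA -trmxC_mul uA trmxC_scale geC0_conj.
have nv0 : vnorm (u^t*) != 0 by rewrite vnorm_eq0.
pose s := (vnorm (u^t*))^-1.
have s0 : 0 <= s by rewrite invr_ge0 vnorm_ge0.
apply: ub_le_sup; first exact: opnorm_has_ubound.
exists (s%:C%C *: u^t*); first by rewrite /= vnormZ // mulVf.
rewrite -scalemxAr Av scalerA mulrC -scalerA (RRe_ge0 a_ge0).
by rewrite !vnormZ ?Re_ge0 //= mulVf // mulr1.
Qed.

Lemma opnorm_ge0 D (A : 'M[R[i]]_D) : 0 <= opnorm A.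
Proof.
rewrite /opnorm; set X := (X in sup X).
have [->|/set0P[x Xx]] := eqVneq X set0; first by rewrite sup0.
case: (Xx) => v v1 Av.
apply: le_trans (vnorm_ge0 (A *m v)) _; apply: ub_le_sup; last by exists v.
exact: opnorm_has_ubound.
Qed.

(** * Energy and ergotropy of one cell *)

Variables (d : nat) (h : 'M[R[i]]_d).
Hypothesis hcell : is_cell_hamiltonian h.

Lemma cell_psd : psdmx h.
Proof.
by case: hcell => hh _ /(hermitian_gram hh)[B ->]; exact: psdmx_gram.
Qed.

(** An eigenvalue [a] of the difference gives the eigenvalue [opnorm h - a] of [h], which is at most
    [opnorm h]. Traced against a state, this bounds the mean energy by [opnorm h]. *)
Lemma opnorm_sub_cell_psd : psdmx ((opnorm h)%:C%C%:M - h).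
Proof.
have [hh _ h_ge0] := hcell; apply/psdmxP; apply: hermitian_gram.
  apply/hermsymmxP; rewrite linearB /= map_mxB (proj1 (hermsymmxP h) hh).
  by rewrite tr_scalar_mx map_scalar_mx /= geC0_conj // ler0c opnorm_ge0.
move=> a /eigenvalueP[v va v0]; pose b := (opnorm h)%:C%C - a.
have hb : eigenvalue h b.
  apply/eigenvalueP; exists v => //; move: va; rewrite mulmxBr mul_mx_scalar.
  by rewrite scalerBl => <-; rewrite opprB addrC subrK.
have b_ge0 := h_ge0 _ hb.
have -> : a = (opnorm h - complex.Re b)%:C%C.
  by rewrite rmorphB /= -(RRe_ge0 b_ge0) /b opprB addrC subrK.
by rewrite ler0c subr_ge0 vnorm_eigen_le_opnorm.
Qed.

Lemma mean_energy_ge0 rho : is_state rho -> 0 <= mean_energy rho h.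
Proof.
by move=> [rho_psd _]; exact/Re_ge0/psdmx_tr_mul_ge0/cell_psd.
Qed.

Lemma mean_energy_le_opnorm rho : is_state rho -> mean_energy rho h <= opnorm h.
Proof.
move=> [rho_psd rho1].
have := Re_ge0 (psdmx_tr_mul_ge0 rho_psd opnorm_sub_cell_psd).
rewrite mulmxBr mul_mx_scalar raddfB /= linearZ /= rho1 mulr1.
by rewrite ReD raddfN /= subr_ge0.
Qed.

Lemma unitary_state (U rho : 'M[R[i]]_d) :
  U \is unitarymx -> is_state rho -> is_state (U *m rho *m U^t*).
Proof.
move=> uU [/psdmxP[B ->] tr1]; split.
  suff -> : U *m (B^t* *m B) *m U^t* = (B *m U^t*)^t* *m (B *m U^t*).
    exact: psdmx_gram.
  by rewrite trmxC_mul trmxCK !mulmxA.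
rewrite mxtrace_mulC mulmxA; have := uU; rewrite -trmxC_unitary.
by move=> /unitarymxP; rewrite trmxCK => ->; rewrite mul1mx.
Qed.

Lemma ergotropy_has_ubound rho : is_state rho ->
  ubound [set mean_energy rho h - mean_energy (U *m rho *m U ^t*) h
      | U in [set U : 'M[R[i]]_d | U \is unitarymx]] (mean_energy rho h).
Proof.
move=> rhoS _ [U /= uU <-]; rewrite gerBl.
exact/mean_energy_ge0/unitary_state.
Qed.

Lemma le_ergotropy rho U : is_state rho -> U \is unitarymx ->
  mean_energy rho h - mean_energy (U *m rho *m U ^t*) h <= ergotropy rho h.
Proof.
move=> rhoS uU; apply: ub_le_sup; last by exists U.
by exists (mean_energy rho h); exact: ergotropy_has_ubound.
Qed.

Lemma unitarymx1 n : (1%:M : 'M[R[i]]_n) \is unitarymx.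
Proof. by apply/unitarymxP; rewrite trmx1 map_mx1 mulmx1. Qed.

Lemma ergotropy_ge0 rho : is_state rho -> 0 <= ergotropy rho h.
Proof.
move=> rhoS; have := le_ergotropy rhoS (unitarymx1 d).
by rewrite trmx1 map_mx1 mulmx1 mul1mx subrr.
Qed.

Lemma ergotropy_le_opnorm rho : is_state rho -> ergotropy rho h <= opnorm h.
Proof.
move=> rhoS; apply: le_trans (mean_energy_le_opnorm rhoS).
apply: ge_sup; last exact: ergotropy_has_ubound.
by eexists; exists 1%:M => //; exact: unitarymx1.
Qed.


(** The projector on a normalised null vector of [h]. It fits every energy bound >= 0, and so is the
    witness that the sets of admissible inputs are nonempty. *)
Lemma ground_state :
  exists2 rho : 'M[R[i]]_d, is_state rho & mean_energy rho h = 0.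
Proof.
have [_ /eigenvalueP[u uh u0] _] := hcell.
have nv0 : vnorm (u^t*) != 0.
  rewrite vnorm_eq0; apply: contraNneq u0 => v0.
  by rewrite -[u]trmxCK v0 trmx0 map_mx0.
pose B := ((vnorm (u^t*))^-1)%:C%C *: u.
have BB : (B *m B^t*) 0 0 = 1.
  rewrite -{1}[B]trmxCK -sqr_vnorm trmxC_scale.
  rewrite geC0_conj ?ler0c ?invr_ge0 ?vnorm_ge0 //.
  by rewrite vnormZ ?invr_ge0 ?vnorm_ge0 // mulVf // expr1n.
exists (B^t* *m B).
  split; first exact: psdmx_gram.
  by rewrite mxtrace_mulC /mxtrace big_ord1.
by rewrite /mean_energy -mulmxA -scalemxAl uh scale0r scaler0 mulmx0 mxtrace0.
Qed.

End SingleCell.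

(** * Channels on one cell and the single-cell maximum *)

Section Channels.
Variables (R : realType) (d : nat) (h : 'M[R[i]]_d).
Variable L : {linear 'M[R[i]]_d -> 'M[R[i]]_d}.
Hypothesis hcell : is_cell_hamiltonian h.
Hypothesis Lcp : completely_positive L.
Hypothesis Ltp : trace_preserving L.

(** Complete positivity with a one-dimensional ancilla; the two [mxsub] only translate between the
    index types ['I_d] and ['I_(1 * d)]. *)
Lemma completely_positive_psd (A : 'M[R[i]]_d) : psdmx A -> psdmx (L A).
Proof.
move=> psdA; pose X := mxsub (fun k : 'I_(1 * d) => (mxtens_unindex k).2)
  (fun k : 'I_(1 * d) => (mxtens_unindex k).2) A.
have := Lcp (psdmx_mxsub _ psdA : psdmx X).
move=> /(psdmx_mxsub (fun a : 'I_d => mxtens_index (0 : 'I_1, a))).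
congr psdmx; rewrite /ampliation !big_ord1; apply/matrixP => a b.
rewrite mxE tensmxE mxE eqxx mul1r; congr (L _ a b).
by apply/matrixP => x y; rewrite !mxE !mxtens_indexK.
Qed.

Lemma channel_state rho : is_state rho -> is_state (L rho).
Proof.
by move=> [psd_rho tr1]; split; [exact: completely_positive_psd|rewrite Ltp].
Qed.

Lemma max_ergotropy1_has_sup en : 0 <= en ->
  has_sup [set ergotropy (L rho) h | rho in energy_states h en].
Proof.
move=> en0; split; last first.
  exists (opnorm h) => _ [rho [rhoS _] <-].
  exact/ergotropy_le_opnorm/channel_state.
have [g gS g0] := ground_state hcell.
by exists (ergotropy (L g) h), g => //; split; rewrite ?g0.
Qed.

Lemma le_max_ergotropy1 rho en : is_state rho -> mean_energy rho h <= en ->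
  ergotropy (L rho) h <= max_ergotropy1 L h en.
Proof.
move=> rhoS rho_en; apply: ub_le_sup; last by exists rho.
have [] // := @max_ergotropy1_has_sup en.
by apply: le_trans rho_en; exact: mean_energy_ge0.
Qed.

Lemma max_ergotropy1_ge0 en : 0 <= en -> 0 <= max_ergotropy1 L h en.
Proof.
move=> en0; have [g gS g0] := ground_state hcell.
apply: le_trans (_ : ergotropy (L g) h <= _).
  exact/ergotropy_ge0/channel_state.
by apply: le_max_ergotropy1 => //; rewrite g0.
Qed.

Lemma max_ergotropy1_le_opnorm en : 0 <= en ->
  max_ergotropy1 L h en <= opnorm h.
Proof.
move=> /max_ergotropy1_has_sup[ne _]; apply: ge_sup => // _ [rho [rhoS _] <-].
exact/ergotropy_le_opnorm/channel_state.
Qed.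

End Channels.

(** Independent choices of near-optimal elements lose only [eps] in total. This lets sums of maxima
    be bounded without proving that the maxima are attained. *)
Lemma sum_sup_le (R : realType) (I : finType) (S : I -> set R) (y : R) :
  (forall j, has_sup (S j)) ->
  (forall x : I -> R, (forall j, S j (x j)) -> \sum_j x j <= y) ->
  \sum_j sup (S j) <= y.
Proof.
move=> supS leS; apply/ler_addgt0Pr => eps eps0.
(* The successor keeps the denominator positive when [I] is empty. *)
pose del := eps / (#|I|.+1)%:R.
have del0 : 0 < del by rewrite divr_gt0.
have adh j : {x | S j x & sup (S j) - del < x}.
  by apply: cid2; exact: sup_adherent.
have := leS (fun j => s2val (adh j)) (fun j => s2valP (adh j)).
rewrite -(lerD2r eps); apply: le_trans.
apply: le_trans (_ : \sum_j (s2val (adh j) + del) <= _).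
  by apply: ler_sum => j _; rewrite -lerBlDr ltW // (s2valP' (adh j)).
rewrite big_split /= lerD2l sumr_const -[del *+ _]mulr_natr /del mulrAC.
by rewrite ler_pdivrMr // ler_wpM2l ?ler_nat ?ltW.
Qed.

(** * Tensor products, local maps and marginals *)

Section Tensor.
Variables (R : realType) (n d : nat).
Implicit Types A B U : 'I_n -> 'M[R[i]]_d.
Local Notation N := (nbasis n d).

Lemma sum_letters (F : {ffun 'I_n -> 'I_d} -> R[i]) :
  \sum_(a : 'I_N) F (letters a) = \sum_f F f.
Proof. by rewrite /letters -big_enum_val. Qed.

(** The sum over words of a product over cells factorises into a product of sums over letters, by
    distributivity. *)
Lemma tensor_mul A B : tensor A *m tensor B = tensor (fun j => A j *m B j).
Proof.
apply/matrixP => a b; rewrite !mxE.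
under eq_bigr do rewrite !mxE -big_split /=.
pose F j x := A j (letters a j) x * B j x (letters b j).
rewrite (sum_letters (fun f => \prod_j F j (f j))) -(bigA_distr_bigA F).
by apply: eq_bigr => j _; rewrite mxE.
Qed.

Lemma tr_tensor A : \tr (tensor A) = \prod_j \tr (A j).
Proof.
rewrite /mxtrace (bigA_distr_bigA (fun j x => A j x x)) -sum_letters.
by apply: eq_bigr => a _; rewrite mxE.
Qed.

Lemma trmxC_tensor A : (tensor A)^t* = tensor (fun j => (A j)^t*).
Proof.
apply/matrixP => a b; rewrite !mxE rmorph_prod.
by apply: eq_bigr => j _; rewrite !mxE.
Qed.

Lemma eq_tensor A B : A =1 B -> tensor A = tensor B.
Proof.
move=> AB; apply/matrixP => a b; rewrite !mxE.
by apply: eq_bigr => j _; rewrite AB.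
Qed.

Lemma letters_inj : injective (@letters n d).
Proof. exact: enum_val_inj. Qed.

Lemma prod_deltaE (a b : {ffun 'I_n -> 'I_d}) :
  \prod_j ((a j == b j)%:R : R[i]) = (a == b)%:R.
Proof.
case: eqP => [->|/eqP]; first by rewrite big1 // => j _; rewrite eqxx.
move=> ab; have [j {}ab] : exists j, a j != b j.
  apply/existsP; apply: contraNT ab; rewrite negb_exists => /forallP ab.
  by apply/eqP/ffunP => k; apply/eqP; have := ab k; rewrite negbK.
by rewrite (bigD1 j) //= (negbTE ab) mul0r.
Qed.

Lemma tensor1 : tensor (fun _ : 'I_n => 1%:M : 'M[R[i]]_d) = 1%:M.
Proof.
apply/matrixP => a b; rewrite !mxE.
under eq_bigr do rewrite mxE.
by rewrite prod_deltaE (inj_eq letters_inj).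
Qed.

Lemma tensor_map_id (X : 'M[R[i]]_N) : tensor_map id X = X.
Proof.
rewrite [RHS]matrix_sum_delta /tensor_map; apply: eq_bigr => a _.
apply: eq_bigr => b _; congr (_ *: _); apply/matrixP => x y; rewrite !mxE.
under eq_bigr do rewrite mxE -mulnb natrM.
rewrite big_split /= !prod_deltaE !(inj_eq letters_inj).
by rewrite -natrM mulnb.
Qed.

Lemma psdmx_tensor A : (forall j, psdmx (A j)) -> psdmx (tensor A).
Proof.
move=> psdA; have B j : {B : 'M[R[i]]_d | A j = B^t* *m B}.
  by apply: cid; apply/psdmxP.
have -> : tensor A = (tensor (fun j => projT1 (B j)))^t* *m
    tensor (fun j => projT1 (B j)).
  rewrite trmxC_tensor tensor_mul; apply: eq_tensor => j.
  exact: projT2 (B j).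
exact: psdmx_gram.
Qed.

Lemma tensor_state A : (forall j, is_state (A j)) -> is_state (tensor A).
Proof.
move=> AS; split; first by apply: psdmx_tensor => j; case: (AS j).
by rewrite tr_tensor big1 // => j _; case: (AS j).
Qed.

(** The partial trace over all cells except [j]: the product of deltas keeps the entries whose two
    words agree off cell [j]. *)
Definition marginal (j : 'I_n) (rho : 'M[R[i]]_N) : 'M[R[i]]_d :=
  \sum_a \sum_b
    (rho a b * \prod_(k | k != j) (letters a k == letters b k)%:R) *:
    delta_mx (letters a j) (letters b j).

Lemma tr_tensor_map (L : 'M[R[i]]_d -> 'M[R[i]]_d) (rho : 'M[R[i]]_N) U M :
  \tr (tensor U *m tensor_map L rho *m (tensor U)^t* *m tensor M) =
  \sum_a \sum_b rho a b *
    \prod_k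
      \tr (U k *m L (delta_mx (letters a k) (letters b k)) *m (U k)^t* *m M k).
Proof.
rewrite /tensor_map mulmx_sumr !mulmx_suml raddf_sum; apply: eq_bigr => a _.
rewrite mulmx_sumr !mulmx_suml raddf_sum; apply: eq_bigr => b _ /=.
rewrite -scalemxAr -!scalemxAl linearZ /=; congr (_ * _).
by rewrite trmxC_tensor !tensor_mul tr_tensor.
Qed.

(** A one-cell observable sees only the marginal. On a matrix unit, each cell [k != j] contributes
    the trace of [U k *m L (delta_mx _ _) *m (U k)^t*]; unitarity and trace preservation reduce it
    to the delta in [marginal]. *)
Lemma tr_local (L : {linear 'M[R[i]]_d -> 'M[R[i]]_d}) (rho : 'M[R[i]]_N)
    U M j :
  trace_preserving L -> (forall k, U k \is unitarymx) ->
  \tr (tensor U *m tensor_map L rho *m (tensor U)^t* *m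
       tensor (fun k => if k == j then M else 1%:M)) =
  \tr (U j *m L (marginal j rho) *m (U j)^t* *m M).
Proof.
move=> Ltp uU; rewrite tr_tensor_map /marginal.
rewrite raddf_sum mulmx_sumr !mulmx_suml raddf_sum; apply: eq_bigr => a _.
rewrite raddf_sum mulmx_sumr !mulmx_suml raddf_sum; apply: eq_bigr => b _ /=.
rewrite [in RHS]linearZ -scalemxAr -!scalemxAl linearZ /= -mulrA; congr (_ * _).
rewrite (bigD1 j) //= eqxx mulrC; congr (_ * _).
apply: eq_bigr => k /negbTE ->; rewrite mulmx1 mxtrace_mulC mulmxA.
have := uU k; rewrite -trmxC_unitary => /unitarymxP; rewrite trmxCK => ->.
rewrite mul1mx Ltp /mxtrace (bigD1 (letters a k)) //= mxE eqxx big1 ?addr0 //.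
by move=> x /negbTE xa; rewrite mxE xa.
Qed.

(** The case of the identity channel and identity unitaries. It characterises the marginal by its
    traces, and all later facts on marginals come from it. *)
Lemma tr_marginal (rho : 'M[R[i]]_N) M j :
  \tr (rho *m tensor (fun k => if k == j then M else 1%:M)) =
  \tr (marginal j rho *m M).
Proof.
have := @tr_local idfun rho (fun=> 1%:M) M j (fun=> erefl)
  (fun=> unitarymx1 _ _).
by rewrite tensor1 tensor_map_id !trmx1 !map_mx1 !mulmx1 !mul1mx.
Qed.

(** Turns entries into traces, so that entrywise identities for marginals follow from
    [tr_marginal]. *)
Lemma tr_mul_delta (A : 'M[R[i]]_d) x y : \tr (A *m delta_mx y x) = A x y.
Proof.
rewrite /mxtrace (bigD1 x) //= big1 ?addr0 => [|z /negbTE zx].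
  rewrite mxE (bigD1 y) //= big1 ?addr0 => [|z /negbTE zy].
    by rewrite mxE !eqxx mulr1.
  by rewrite mxE zy mulr0.
by rewrite mxE big1 // => w _; rewrite mxE zx andbF mulr0.
Qed.

Lemma tr_hermitianJ D (A B : 'M[R[i]]_D) :
  A \is hermsymmx -> \tr (A *m B^t*) = (\tr (A *m B))^*.
Proof.
move=> /hermsymmxP hA; rewrite mxtrace_mulC -{1}hA -trmxC_mul.
by rewrite /mxtrace rmorph_sum; apply: eq_bigr => k _; rewrite !mxE.
Qed.

Lemma marginal_state j rho : is_state rho -> is_state (marginal j rho).
Proof.
move=> [psd_rho tr1]; split; last first.
  rewrite -[marginal j rho]mulmx1 -tr_marginal -[RHS]tr1 -[in RHS](mulmx1 rho).
  rewrite -tensor1; congr (\tr (_ *m _)); apply: eq_tensor => k; by case: ifP.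
split.
  have [hrho _] := psd_rho; apply/hermsymmxP/matrixP => x y.
  rewrite !mxE -!tr_mul_delta -!tr_marginal -tr_hermitianJ // trmxC_tensor.
  congr (\tr (_ *m _)); apply: eq_tensor => k; case: ifP => _.
    by rewrite trmx_delta map_delta_mx.
  by rewrite trmx1 map_mx1.
(* [v^* rho_j v] is the trace of [rho] against the positive tensor with [v v^*]
   on cell [j]. *)
move=> v; have -> : (v^t* *m marginal j rho *m v) 0 0 =
    \tr (marginal j rho *m (v *m v^t*)).
  by rewrite mulmxA mxtrace_mulC mulmxA /mxtrace big_ord1.
rewrite -tr_marginal; apply: psdmx_tr_mul_ge0 => //.
apply: psdmx_tensor => k; case: ifP => _.
  by rewrite -{1}[v]trmxCK; exact: psdmx_gram.
by have := psdmx_gram (1%:M : 'M[R[i]]_d); rewrite trmx1 map_mx1 mulmx1.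
Qed.

Lemma marginal_tensor (s : 'I_n -> 'M[R[i]]_d) j :
  (forall k, \tr (s k) = 1) -> marginal j (tensor s) = s j.
Proof.
move=> tr1; apply/matrixP => x y; rewrite -!tr_mul_delta -tr_marginal.
rewrite tensor_mul tr_tensor (bigD1 j) //= eqxx big1 ?mulr1 // => k /negbTE ->.
by rewrite mulmx1.
Qed.

End Tensor.

(** * Local ergotropy of many cells, and the upper bound by chi *)

Section ManyCellErgotropy.
Variables (R : realType) (d : nat) (h : 'M[R[i]]_d).
Variable L : {linear 'M[R[i]]_d -> 'M[R[i]]_d}.
Hypothesis hcell : is_cell_hamiltonian h.
Hypothesis Lcp : completely_positive L.
Hypothesis Ltp : trace_preserving L.

Section FixedNumber.
Variable n : nat.
Local Notation H := (total_hamiltonian n h).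
Implicit Types rho : 'M[R[i]]_(nbasis n d).

Lemma mean_energy_total rho :
  mean_energy rho H = \sum_j mean_energy (marginal j rho) h.
Proof.
rewrite /mean_energy mulmx_sumr (raddf_sum (@mxtrace _ _)) Re_sum /=.
by apply: eq_bigr => j _; rewrite tr_marginal.
Qed.

Lemma mean_energy_local_unitary rho (U : 'I_n -> 'M[R[i]]_d) :
  (forall j, U j \is unitarymx) ->
  mean_energy (tensor U *m tensor_map L rho *m (tensor U)^t*) H =
  \sum_j mean_energy (U j *m L (marginal j rho) *m (U j)^t*) h.
Proof.
move=> uU; rewrite /mean_energy mulmx_sumr (raddf_sum (@mxtrace _ _)) Re_sum /=.
by apply: eq_bigr => j _; rewrite tr_local.
Qed.

Lemma mean_energy_output rho :
  mean_energy (tensor_map L rho) H = \sum_j mean_energy (L (marginal j rho)) h.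
Proof.
have := @mean_energy_local_unitary rho (fun=> 1%:M) (fun=> unitarymx1 _ _).
rewrite tensor1 trmx1 map_mx1 mul1mx mulmx1 => ->.
by under eq_bigr do rewrite trmx1 map_mx1 mul1mx mulmx1.
Qed.

(** The gain of a local unitary splits into one term per cell, each depending on its own [U j], and
    these are chosen independently: the supremum of the sum is the sum of the suprema. *)
Lemma local_ergotropyE rho : is_state rho ->
  local_ergotropy h (tensor_map L rho) =
  \sum_j ergotropy (L (marginal j rho)) h.
Proof.
move=> rhoS; have LS j : is_state (L (marginal j rho)).
  exact/channel_state/marginal_state.
have gainE U : (forall j, U j \is unitarymx) ->
    mean_energy (tensor_map L rho) H
      - mean_energy (tensor U *m tensor_map L rho *m (tensor U) ^t*) H =
    \sum_j (mean_energy (L (marginal j rho)) h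
      - mean_energy (U j *m L (marginal j rho) *m (U j)^t*) h).
  by move=> uU; rewrite mean_energy_output mean_energy_local_unitary // sumrB.
have ub : ubound [set mean_energy (tensor_map L rho) H
      - mean_energy (tensor U *m tensor_map L rho *m (tensor U) ^t*) H
      | U in [set U : 'I_n -> 'M[R[i]]_d | forall i, U i \is unitarymx]]
    (\sum_j ergotropy (L (marginal j rho)) h).
  move=> _ [U /= uU <-]; rewrite gainE //.
  by apply: ler_sum => j _; exact: le_ergotropy.
apply/eqP; rewrite eq_le; apply/andP; split.
  apply: ge_sup ub.
  by eexists; exists (fun=> 1%:M) => //= j; exact: unitarymx1.
apply: sum_sup_le => [j|x xj].
  split; last by eexists; exact: ergotropy_has_ubound.
  by eexists; exists 1%:M => //; exact: unitarymx1.
have {xj} U j : {U | U \is unitarymx & mean_energy (L (marginal j rho)) h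
      - mean_energy (U *m L (marginal j rho) *m U^t*) h = x j}.
  by apply: cid2; exact: xj.
have uU j : s2val (U j) \is unitarymx by exact: s2valP (U j).
apply: ub_le_sup; first by eexists; exact: ub.
exists (fun j => s2val (U j)) => //=; rewrite gainE //.
by apply: eq_bigr => j _; exact: s2valP' (U j).
Qed.

Lemma local_ergotropy_le rho : is_state rho ->
  local_ergotropy h (tensor_map L rho) <= n%:R * opnorm h.
Proof.
move=> rhoS; rewrite local_ergotropyE //.
rewrite mulr_natl -[n in leRHS]card_ord -sumr_const; apply: ler_sum => j _.
exact/ergotropy_le_opnorm/channel_state/marginal_state.
Qed.

(** Single-cell inputs of energies at most [en j] are combined into their product, which is
    separable, has those inputs as marginals, and has energy at most [E]. *)
Lemma sum_max_ergotropy1_le_sep (en : 'I_n -> R) E :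
  (forall j, 0 <= en j) -> \sum_j en j <= E ->
  \sum_j max_ergotropy1 L h (en j) <= max_local_ergotropy_sep n L h E.
Proof.
move=> en_ge0 enE; apply: sum_sup_le => [j|x xj].
  exact: max_ergotropy1_has_sup.
have {xj} s j : {rho | energy_states h (en j) rho & ergotropy (L rho) h = x j}.
  by apply: cid2; exact: xj.
pose sv j := s2val (s j).
have svS j : is_state (sv j) by case: (s2valP (s j)).
have svE j : mean_energy (sv j) h <= en j by case: (s2valP (s j)).
have margE j : marginal j (tensor sv) = sv j.
  by apply: marginal_tensor => k; case: (svS k).
apply: ub_le_sup.
  exists (n%:R * opnorm h) => _ [rho [[rhoS _] _] <-].
  exact: local_ergotropy_le.
exists (tensor sv); last first.
  rewrite local_ergotropyE; last exact: tensor_state.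
  by apply: eq_bigr => j _; rewrite margE; exact: s2valP' (s j).
split; first split.
- exact: tensor_state.
- rewrite mean_energy_total; apply: le_trans enE; apply: ler_sum => j _.
  by rewrite margE.
(* A product state is a convex combination with a single term. *)
- exists 1%N, (fun=> 1), (fun=> sv); split => //; first by rewrite big_ord1.
  by rewrite big_ord1 scale1r.
Qed.

Lemma max_local_ergotropy_sep_le E : 0 <= E ->
  max_local_ergotropy_sep n L h E <= max_local_ergotropy n L h E.
Proof.
move=> E0; apply: ge_sup; last first.
  move=> _ [rho [rhoE _] <-]; apply: ub_le_sup; last by exists rho.
  by exists (n%:R * opnorm h) => _ [r [rS _] <-]; exact: local_ergotropy_le.
have [g gS g0] := ground_state hcell.
exists (local_ergotropy h (tensor_map L (tensor (fun _ : 'I_n => g)))).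
exists (tensor (fun=> g)) => //; split; first split.
- exact: tensor_state.
- rewrite mean_energy_total big1 // => j _.
  by rewrite marginal_tensor // => _; case: gS.
- exists 1%N, (fun=> 1), (fun _ _ => g); split => //; first by rewrite big_ord1.
  by rewrite big_ord1 scale1r.
Qed.

End FixedNumber.

Lemma chi_has_sup e : 0 <= e ->
  has_sup [set x | exists (m : nat) (p en : 'I_m -> R),
    [/\ forall j, 0 <= p j, \sum_j p j = 1,
        forall j, 0 <= en j <= opnorm h, \sum_j p j * en j <= e &
        x = \sum_j p j * max_ergotropy1 L h (en j)]].
Proof.
move=> e0; split.
  eexists; exists 1%N, (fun=> 1), (fun=> 0); split => //.
  - by rewrite big_ord1.
  - by move=> j; rewrite lexx opnorm_ge0.
  - by rewrite big_ord1 mulr0.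
exists (opnorm h) => _ [m [p [en [p0 p1 enb _ ->]]]].
rewrite -[leRHS]mul1r -p1 mulr_suml; apply: ler_sum => j _.
apply: ler_wpM2l => //; apply: max_ergotropy1_le_opnorm => //.
by case/andP: (enb j).
Qed.

(** The energies of the [n] marginals lie in [[0, opnorm h]] and add up to at most [n e], so with
    weights [1/n] they compete in the supremum defining [chi]. *)
Lemma max_local_ergotropy_le_chi n e : 0 <= e -> (0 < n)%N ->
  max_local_ergotropy n L h (n%:R * e) <= n%:R * chi L h e.
Proof.
move=> e0 n0; have nR : 0 < n%:R :> R by rewrite ltr0n.
(* At [m = 1] this says that the uniform weights add up to 1. *)
have nV m : m = \sum_(j < n) n%:R^-1 * m :> R.
  by rewrite sumr_const card_ord -[RHS]mulr_natl mulVKf // gt_eqF.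
apply: ge_sup.
  have [g gS g0] := ground_state hcell.
  eexists; exists (tensor (fun=> g)) => //; split; first exact: tensor_state.
  rewrite mean_energy_total big1 ?mulr_ge0 // => j _.
  by rewrite marginal_tensor // => _; case: gS.
move=> _ [rho [rhoS rhoE] <-]; rewrite local_ergotropyE //.
pose en j := mean_energy (marginal j rho) h.
have mS j : is_state (marginal j rho) by exact: marginal_state.
apply: le_trans (_ : \sum_j max_ergotropy1 L h (en j) <= _).
  by apply: ler_sum => j _; exact: le_max_ergotropy1.
rewrite -ler_pdivrMl // mulr_sumr; apply: ub_le_sup.
  by have [] := chi_has_sup e0.
exists n, (fun=> n%:R^-1), en; split => //.
- by rewrite [RHS]nV; apply: eq_bigr => j _; rewrite mulr1.
- by move=> j; rewrite mean_energy_ge0 // mean_energy_le_opnorm.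
- by rewrite -mulr_sumr ler_pdivrMl // -mean_energy_total.
Qed.

End ManyCellErgotropy.

(** * Rounding a distribution to [n] equally weighted points *)

Section Rounding.
Variable R : realType.

(* [c j = floor (n p_j)] copies of the value [en j], padded with zeros. *)
Lemma rounded_distribution (m n : nat) (p en : 'I_m -> R) (F : R -> R) (M : R) :
  (forall j, 0 <= p j) -> \sum_j p j = 1 -> (forall j, 0 <= en j) ->
  (forall x, 0 <= x -> 0 <= F x <= M) ->
  exists en' : 'I_n -> R,
    [/\ forall k, 0 <= en' k, \sum_k en' k <= n%:R * \sum_j p j * en j &
        n%:R * (\sum_j p j * F (en j)) - m%:R * M <= \sum_k F (en' k)].
Proof.
move=> p0 p1 en0 F0M; pose c j := Num.truncn (n%:R * p j).
have np0 j : 0 <= n%:R * p j by rewrite mulr_ge0.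
have c_le j : (c j)%:R <= n%:R * p j by rewrite truncn_le.
have c_gt j : n%:R * p j - 1 <= (c j)%:R.
  by rewrite lerBlDr natr1 ltW ?truncnS_gt.
have sum_c : (\sum_j c j <= n)%N.
  rewrite -(ler_nat R) natr_sum.
  have -> : n%:R = \sum_j n%:R * p j by rewrite -mulr_sumr p1 mulr1.
  by apply: ler_sum => j _; exact: c_le.
(* Since the [c j] add up to at most [n], the padding gives length exactly [n]; zeros add no
   energy. *)
pose s := flatten [seq nseq (c j) (en j) | j <- enum 'I_m] ++
  nseq (n - \sum_j c j) 0.
have sum_s (G : R -> R) : \sum_(x <- s) G x =
    \sum_j (c j)%:R * G (en j) + (n - \sum_j c j)%:R * G 0.
  rewrite big_cat big_flatten big_map big_enum /=; congr (_ + _).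
    by apply: eq_bigr => j _; rewrite big_nseq iter_addr addr0 mulr_natl.
  by rewrite big_nseq iter_addr addr0 mulr_natl.
have size_s : size s = n.
  rewrite size_cat size_flatten size_nseq sumnE /shape 2!big_map big_enum /=.
  under eq_bigr do rewrite size_nseq.
  by rewrite subnKC.
have s_ge0 x : x \in s -> 0 <= x.
  rewrite mem_cat => /orP[/flattenP[_ /mapP[j _ ->]]|].
    by rewrite mem_nseq => /andP[_ /eqP->].
  by rewrite mem_nseq => /andP[_ /eqP->].
have sum_nth (G : R -> R) : \sum_(k < n) G (nth 0 s k) = \sum_(x <- s) G x.
  by rewrite (big_nth 0) size_s big_mkord.
exists (fun k => nth 0 s k); split.
- by move=> k; apply/s_ge0/mem_nth; rewrite size_s.
- rewrite (sum_nth id) sum_s mulr0 addr0 mulr_sumr; apply: ler_sum => j _.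
  by rewrite mulrA ler_wpM2r.
(* The padding may be dropped because [F 0 >= 0]. Each floor loses at most one copy, worth at most
   [M], hence the total loss [m M]. *)
- rewrite sum_nth sum_s; have /andP[F00 _] := F0M 0 (lexx 0).
  apply: le_trans (_ : \sum_j (c j)%:R * F (en j) <= _); last first.
    by rewrite lerDl mulr_ge0.
  have -> : m%:R * M = \sum_(j < m) M by rewrite sumr_const card_ord mulr_natl.
  rewrite lerBlDr mulr_sumr -big_split /=; apply: ler_sum => j _.
  have /andP[Fj0 FjM] := F0M _ (en0 j); rewrite mulrA.
  apply: le_trans (_ : ((c j)%:R + 1) * F (en j) <= _).
    by rewrite ler_wpM2r // -lerBlDr.
  by rewrite mulrDl mul1r lerD2l.
Qed.

End Rounding.

(** * Convergence of both rates to chi *)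

Section Capacitance.
Variables (R : realType) (d : nat) (h : 'M[R[i]]_d).
Variable L : {linear 'M[R[i]]_d -> 'M[R[i]]_d}.
Hypothesis hcell : is_cell_hamiltonian h.
Hypothesis Lcp : completely_positive L.
Hypothesis Ltp : trace_preserving L.
Variable e : R.
Hypothesis e0 : 0 <= e.

Lemma local_rate_le_chi n : (0 < n)%N -> local_rate L h e n <= chi L h e.
Proof.
move=> n0; rewrite /local_rate ler_pdivrMr ?ltr0n // [leRHS]mulrC.
exact: max_local_ergotropy_le_chi.
Qed.

Lemma local_rate_sep_le n : local_rate_sep L h e n <= local_rate L h e n.
Proof.
by rewrite ler_wpM2r ?invr_ge0 // max_local_ergotropy_sep_le // mulr_ge0.
Qed.

(** Half of [eps] pays for a near-optimal distribution, fixed before [n]; the other half pays for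
    rounding it to [n] cells. *)
Lemma chi_le_local_rate_sep (eps : R) : 0 < eps ->
  \forall n \near \oo, chi L h e - eps <= local_rate_sep L h e n.
Proof.
move=> eps0; have eps20 : 0 < eps / 2 by rewrite divr_gt0.
have [x [m [p [en [p0 p1 enb ene xE]]]] chi_x] :=
  sup_adherent eps20 (chi_has_sup hcell Lcp Ltp e0).
near=> n.
have n0 : (0 < n)%N by near: n; exact: nbhs_infty_gt.
have nR : 0 < n%:R :> R by rewrite ltr0n.
(* The rounding loss [m * opnorm h] is independent of [n], so for large [n] it is at most
   [n * eps / 2]. *)
have nbig : m%:R * opnorm h / (eps / 2) <= n%:R.
  by near: n; exact: nbhs_infty_ger.
have F0M y : 0 <= y -> 0 <= max_ergotropy1 L h y <= opnorm h.
  by move=> y0; rewrite max_ergotropy1_ge0 // max_ergotropy1_le_opnorm.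
have en_ge0 j : 0 <= en j by case/andP: (enb j).
have [en' [en'0 sum_en' F_en']] := rounded_distribution n p0 p1 en_ge0 F0M.
have en'E : \sum_k en' k <= n%:R * e.
  by apply: le_trans sum_en' _; rewrite ler_pM2l.
rewrite /local_rate_sep ler_pdivlMr //.
apply: le_trans (sum_max_ergotropy1_le_sep hcell Lcp Ltp en'0 en'E).
apply: le_trans F_en'; rewrite -xE.
move: nbig; rewrite ler_pdivrMr // => nbig.
have : n%:R * (chi L h e - eps / 2) <= n%:R * x by rewrite ler_pM2l // ltW.
rewrite /chi in chi_x *; lra.
Unshelve. all: by end_near.
Qed.

(** The upper bound goes through the unrestricted rate, which [chi] dominates for every [n > 0];
    only the lower bound is asymptotic. *)
Lemma cvg_local_rate_sep : local_rate_sep L h e @ \oo --> chi L h e.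
Proof.
apply/cvgrPdist_le => eps eps0; near=> n.
have n0 : (0 < n)%N by near: n; exact: nbhs_infty_gt.
rewrite ger0_norm.
  rewrite lerBlDr -lerBlDl; near: n; exact: chi_le_local_rate_sep.
rewrite subr_ge0; apply: le_trans (local_rate_sep_le n) _.
exact: local_rate_le_chi.
Unshelve. all: by end_near.
Qed.

Lemma cvg_local_rate : local_rate L h e @ \oo --> chi L h e.
Proof.
apply: squeeze_cvgr cvg_local_rate_sep (cvg_cst (chi L h e)).
near=> n; rewrite local_rate_sep_le local_rate_le_chi //.
near: n; exact: nbhs_infty_gt.
Unshelve. all: by end_near.
Qed.

End Capacitance.

Unset Implicit Arguments.

Theorem theorem1 (R : realType) (d : nat) (h : 'M[R[i]]_d)
    (L : {linear 'M[R[i]]_d -> 'M[R[i]]_d}) (e : R)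
    (hcell : is_cell_hamiltonian h)
    (Lcp : completely_positive L) (Ltp : trace_preserving L)
    (he : 0 <= e <= opnorm h) :
  [/\ cvgn (local_rate L h e), cvgn (local_rate_sep L h e),
      C_loc L h e = C_loc_sep L h e & C_loc_sep L h e = chi L h e].
Proof.
have /andP[e0 _] := he.
have cvg_loc := cvg_local_rate hcell Lcp Ltp e0.
have cvg_sep := cvg_local_rate_sep hcell Lcp Ltp e0.
have sepE : C_loc_sep L h e = chi L h e by exact/cvg_lim.
have locE : C_loc L h e = chi L h e by exact/cvg_lim.
split; [exact: cvgP cvg_loc | exact: cvgP cvg_sep | by rewrite locE | by []].
Qed.
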